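(* Let $X$ be a continuous random variable with cumulative distribution function $F_X$, continuous and strictly increasing on the support of $X$, and probability density function $f_X$. Let $k\ge 1$ be a fixed integer. If $f_X(x)$ is increasing in $x$ (on the support of $X$), then $H(f_{L_{n,k}},f_X)$ is increasing in $n$; that is, $H(f_{L_{n,k}},f_X)\le H(f_{L_{n+1,k}},f_X)$ for every integer $n\ge 1$.
   Context: For positive integers $n,k$, the $n$th lower $k$-record value $L_{n,k}$ from the distribution of $X$ has probability density function $$f_{L_{n,k}}(x)=\frac{k^n}{(n-1)!}\,[-\log F_X(x)]^{n-1}\,[F_X(x)]^{k-1} f_X(x).$$ The Kerridge inaccuracy measure between $L_{n,k}$ and $X$ is $$H(f_{L_{n,k}},f_X)=-\int_{-\infty}^{\infty} f_{L_{n,k}}(x)\log f_X(x)\,dx,$$ where the integral is taken over the support of $X$ and is assumed to be well defined. ''Increasing'' is meant in the non-strict sense. *)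

(* Defs.v *)
From HB Require Import structures.
From mathcomp Require Export all_boot all_order all_algebra.
From mathcomp Require Export all_classical all_reals all_analysis.
Export Order.TTheory GRing.Theory Num.Theory numFieldNormedType.Exports.

Set Implicit Arguments.
Unset Strict Implicit.
Unset Printing Implicit Defensive.

Local Open Scope classical_set_scope.
Local Open Scope ring_scope.

Definition is_pdf (R : realType) (d : measure_display) (T : measurableType d)
    (P : probability T R) (X : {RV P >-> R}) (f : R -> R) : Prop :=
  [/\ measurable_fun setT f,
      forall x, 0 <= f x
    & forall A : set R, measurable A ->
        distribution P X A = (\int[lebesgue_measure]_(x in A) (f x)%:E)%E].

(* The library's [cdf] has values in [\bar R]; they are finite, so that [fine]
   loses nothing. *)
Definition rcdf (R : realType) (d : measure_display) (T : measurableType d)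
    (P : probability T R) (X : {RV P >-> R}) (x : R) : R := fine (cdf X x).

(* The support of a distribution with density [f] is the set where the density
   is positive. *)
Definition pdf_support (R : realType) (f : R -> R) : set R := [set x | 0 < f x].

(* Density of the [n]th lower [k]-record value ([1 <= n], [1 <= k]) from the
   distribution with cumulative distribution function [F] and density [f]. On
   the support of [f], [F] vanishes only on a null set, so that the convention
   [ln 0 = 0] does not affect integrals. *)
Definition lower_record_pdf (R : realType) (F f : R -> R) (n k : nat) (x : R)
    : R :=
  k%:R ^+ n / (n.-1)`!%:R * (- ln (F x)) ^+ n.-1 * F x ^+ k.-1 * f x.

Definition kerridge_integrand (R : realType) (g f : R -> R) (x : R) : \bar R :=
  (g x * ln (f x))%:E.

(* Integrating over the support of [f] makes the value [ln 0 = 0] irrelevant. *)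
Definition kerridge (R : realType) (g f : R -> R) : \bar R :=
  (- \int[lebesgue_measure]_(x in pdf_support f) kerridge_integrand g f x)%E.

(* The integral is well defined when the integrals of the positive and of the
   negative part are not both infinite; the value may still be infinite. *)
Definition kerridge_well_defined (R : realType) (g f : R -> R) : Prop :=
  adde_def
    (\int[lebesgue_measure]_(x in pdf_support f) (kerridge_integrand g f)^\+ x)%E
    (- \int[lebesgue_measure]_(x in pdf_support f)
        (kerridge_integrand g f)^\- x)%E.

(* Main.v *)
Require Import Defs.
From HB Require Import structures.
From mathcomp Require Import measurable_realfun ring lra.

(* Write F, f for the distribution function and density of X, and g_n for the
   density of L_{n,k}. The ratio g_{n+1} / g_n = (k / n) (- ln F) is
   nonincreasing, so that g_{n+1} - g_n changes sign once, from + to -, where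
   F = exp (- n / k). As ln f is nondecreasing, there is a constant c such that
   (g_{n+1} - g_n) (ln f - c) <= 0 on the support. Integrating gives the claim,
   since g_n and g_{n+1} both have integral 1: F(X) is uniform on [0, 1], which
   reduces this to the integral of k^n / (n-1)! (- ln u)^(n-1) u^(k-1). *)

Set Implicit Arguments.
Unset Strict Implicit.
Unset Printing Implicit Defensive.

Local Open Scope classical_set_scope.
Local Open Scope ring_scope.

(** * Integration against a measure that has a density *)

Section density.
Local Open Scope ereal_scope.
Context d (T : measurableType d) (R : realType).
Variables (mu nu : {measure set T -> \bar R}) (f : T -> R).
Hypotheses (mf : measurable_fun setT f) (f_ge0 : forall x, (0 <= f x)%R).
Hypothesis nuE : forall A, measurable A -> nu A = \int[mu]_(x in A) (f x)%:E.

Import HBNNSimple.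

(** A simple function is a finite combination of indicators of its level sets, and on each level set
    the claim is [nuE]. *)
Lemma integral_density_nnsfun (h : {nnsfun T >-> R}) :
  \int[nu]_x (h x)%:E = \int[mu]_x ((h x)%:E * (f x)%:E).
Proof.
have mfE : measurable_fun setT (EFin \o f) by exact/measurable_EFinP.
under eq_integral do rewrite fimfunE -fsumEFin//.
rewrite ge0_integral_fsum//; last 2 first.
  - by move=> r; exact/measurable_EFinP/measurableT_comp.
  - by move=> n x _; rewrite EFinM nnfun_muleindic_ge0.
under [RHS]eq_integral.
  move=> x xD; rewrite fimfunE -fsumEFin// ge0_mule_fsuml; last first.
    by move=> r; rewrite EFinM nnfun_muleindic_ge0.
  over.
rewrite [RHS]ge0_integral_fsum//; last 2 first.
  - move=> r; apply: emeasurable_funM => //.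
    by apply/measurable_EFinP; exact: measurableT_comp.
  - move=> n x _; rewrite mule_ge0//; last by rewrite lee_fin.
    by rewrite EFinM nnfun_muleindic_ge0.
apply: eq_fsbigr => r; rewrite inE => -[t _ <-].
rewrite integralZl_indic_nnsfun// integral_indic// setIT nuE//.
rewrite integral_mkcond -ge0_integralZl//.
- apply: eq_integral => x _; rewrite patchE indicE.
  by case: (x \in _) => /=; rewrite ?mulr1 ?mulr0 ?mule0 ?mul0e.
- apply/(measurable_restrictT _ _).1 => //; exact: measurable_funTS.
- by move=> x _; rewrite erestrict_ge0// => y _; rewrite lee_fin.
- by rewrite lee_fin.
Qed.

(** Monotone convergence on both sides along simple functions increasing to [h]; since [f] is
    nonnegative, the products with [f] increase as well. *)
Lemma ge0_integral_density (h : T -> \bar R) : measurable_fun setT h ->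
  (forall x, 0 <= h x) -> \int[nu]_x h x = \int[mu]_x (h x * (f x)%:E).
Proof.
move=> mh h_ge0; pose g := nnsfun_approx measurableT mh.
have mg n : measurable_fun setT (fun x => (g n x)%:E) by exact/measurable_EFinP.
have gh x : (g n x)%:E @[n --> \oo] --> h x by exact: cvg_nnsfun_approx.
have nd_g x : nondecreasing_seq (fun n => (g n x)%:E).
  by move=> m n mn; rewrite lee_fin; exact/lefP/nd_nnsfun_approx.
transitivity (limn (fun n => \int[nu]_x (g n x)%:E)).
  rewrite -monotone_convergence//.
  - by apply: eq_integral => x _; exact/esym/cvg_lim.
  - by move=> n x _; rewrite lee_fin.
transitivity (limn (fun n => \int[mu]_x ((g n x)%:E * (f x)%:E))).
  congr (limn _); apply/funext => n; exact: integral_density_nnsfun.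
rewrite -monotone_convergence//.
- apply: eq_integral => x _; apply/cvg_lim => //.
  exact: cvgeZr.
- by move=> n; apply: emeasurable_funM => //; exact/measurable_EFinP.
- by move=> n x _; rewrite mule_ge0 ?lee_fin.
- by move=> x _ m n mn; rewrite lee_wpmul2r ?lee_fin//; exact: nd_g.
Qed.

End density.

(** * Comparison of integrals that may be infinite *)

Section comparison.
Local Open Scope ereal_scope.
Context d (T : measurableType d) (R : realType).
Variables (mu : {measure set T -> \bar R}) (D : set T).
Hypothesis mD : measurable D.

Lemma le_funepos_integral_lty (a b : T -> \bar R) (h : T -> \bar R) :
  measurable_fun D a -> measurable_fun D b -> mu.-integrable D h ->
  (forall x, D x -> b^\+ x <= a^\+ x + `|h x|) ->
  \int[mu]_(x in D) a^\+ x < +oo -> \int[mu]_(x in D) b^\+ x < +oo.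
Proof.
move=> ma mb /integrableP[mh ih] le_ba ia.
apply: (@le_lt_trans _ _ (\int[mu]_(x in D) (a^\+ x + `|h x|))).
  apply: ge0_le_integral => //; first exact: measurable_funepos.
  apply: emeasurable_funD; first exact: measurable_funepos.
  exact: measurableT_comp.
rewrite ge0_integralD//; first by rewrite lte_add_pinfty.
  exact: measurable_funepos.
exact: measurableT_comp.
Qed.

Lemma integrable_funeposneg (a : T -> \bar R) : measurable_fun D a ->
  \int[mu]_(x in D) a^\+ x < +oo -> \int[mu]_(x in D) a^\- x < +oo ->
  mu.-integrable D a.
Proof.
move=> ma ap an; apply/integrableP; split => //.
rewrite (eq_integral (a^\+ \+ a^\-)); last first.
  by move=> x _; rewrite -[LHS]/((abse \o a) x) fune_abse.
rewrite ge0_integralD//; first by rewrite lte_add_pinfty.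
  exact: measurable_funepos.
exact: measurable_funeneg.
Qed.

(** If the positive part of [a] has infinite integral, well-definedness makes the integral of [a]
    equal to +oo; if the negative part of [b] does, that of [b] is -oo. Otherwise the bound
    [b <= a + h] makes all four parts finite, and integrating it gives the claim. *)
Lemma le_integral_well_defined (a b h : T -> R) :
  measurable_fun D a -> measurable_fun D b ->
  mu.-integrable D (EFin \o h) -> \int[mu]_(x in D) (h x)%:E = 0 ->
  (forall x, D x -> (b x <= a x + h x)%R) ->
  adde_def (\int[mu]_(x in D) (EFin \o a)^\+ x)
           (- \int[mu]_(x in D) (EFin \o a)^\- x) ->
  adde_def (\int[mu]_(x in D) (EFin \o b)^\+ x)
           (- \int[mu]_(x in D) (EFin \o b)^\- x) ->
  \int[mu]_(x in D) (b x)%:E <= \int[mu]_(x in D) (a x)%:E.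
Proof.
move=> /measurable_EFinP ma /measurable_EFinP mb ih h0 le_ba wa wb.
have [ap|] := ltP (\int[mu]_(x in D) (EFin \o a)^\+ x) +oo; last first.
  rewrite leye_eq => /eqP ap; move: wa.
  rewrite [leRHS]integralE ap /adde_def/= => /negP wa.
  by rewrite addye ?leey//; apply: contra_notN wa => /eqP ->.
have [bn|] := ltP (\int[mu]_(x in D) (EFin \o b)^\- x) +oo; last first.
  rewrite leye_eq => /eqP bn; move: wb.
  rewrite [leLHS]integralE bn adde_defEninfty => wb.
  by rewrite addeNy// leNye.
have bp : \int[mu]_(x in D) (EFin \o b)^\+ x < +oo.
  apply: (le_funepos_integral_lty ma mb ih) => // x Dx.
  rewrite !funeposE/= -!EFin_max -EFinD lee_fin.
  have := le_ba _ Dx; have := ler_norm (h x); have := normr_ge0 (h x).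
  by rewrite /Num.max; do 2 case: ifPn; rewrite -?leNgt; lra.
have an : \int[mu]_(x in D) (EFin \o a)^\- x < +oo.
  (* The negative parts are the positive parts of [- a] and [- b], and [- a <= - b + h], so the
     roles of [a] and [b] are exchanged. *)
  rewrite -funeposN; move: bn; rewrite -funeposN.
  apply: (le_funepos_integral_lty _ _ ih); [exact: measurableT_comp..|] => x Dx.
  rewrite !funeposE/= -!EFin_max -EFinD lee_fin.
  have := le_ba _ Dx; have := ler_norm (h x); have := normr_ge0 (h x).
  by rewrite /Num.max; do 2 case: ifPn; rewrite -?leNgt; lra.
have ia : mu.-integrable D (EFin \o a) by exact: integrable_funeposneg.
have ib : mu.-integrable D (EFin \o b) by exact: integrable_funeposneg.
apply: (@le_trans _ _ (\int[mu]_(x in D) ((EFin \o a) \+ (EFin \o h)) x)).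
  apply: le_integral => //; first exact: integrableD.
  by move=> x /set_mem Dx; rewrite /= -EFinD lee_fin le_ba.
by rewrite integralD_EFin//= h0 adde0.
Qed.

End comparison.

(** * The record density as a function of u = F(x), and its total mass on [0, 1] *)

Section record_weight.
Variable R : realType.
Implicit Types (n k : nat) (u x : R).

(* [lower_record_pdf F f n k x] is [record_weight n k (F x) * f x]. *)
Definition record_weight n k u : R :=
  k%:R ^+ n / (n.-1)`!%:R * (- ln u) ^+ n.-1 * u ^+ k.-1.

(* The derivative of the [i]th term is
   [record_weight i.+1 k u - record_weight i k u] ([record_weight 1 k u] for
   [i = 0]), so that the derivative of the sum telescopes. *)
Definition record_weight_prim n k u : R :=
  \sum_(i < n) k%:R ^+ i / i`!%:R * ((- ln u) ^+ i * u ^+ k).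

Lemma record_weight_ge0 n k u : 0 <= u <= 1 -> 0 <= record_weight n k u.
Proof.
move=> /andP[u0 u1]; rewrite mulr_ge0 ?exprn_ge0// mulr_ge0 ?divr_ge0//.
by rewrite exprn_ge0// oppr_ge0 ln_le0.
Qed.

Lemma measurable_record_weight n k : measurable_fun setT (record_weight n k).
Proof.
apply: measurable_funM; last exact: measurable_funX.
apply: measurable_funM => //; apply: measurable_funX.
by apply: measurableT_comp => //; exact: measurable_ln.
Qed.

Lemma is_derive_record_weight_prim n k x : 0 < x ->
  is_derive x 1 (record_weight_prim n.+1 k.+1) (record_weight n.+1 k.+1 x).
Proof.
move=> x0; have dln := is_derive1_ln x0; elim: n => [|n IHn].
  rewrite (_ : record_weight_prim _ _ = @id R ^+ k.+1); last first.
    apply/funext => u; rewrite /record_weight_prim big_ord1 expr0 fact0 divr1.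
    by rewrite !mul1r exprfctE.
  apply: is_derive_eq; rewrite /record_weight /= expr0 expr1 fact0 divr1 mulr1.
  by rewrite -[LHS]/(_ * _) mulr1.
rewrite (_ : record_weight_prim _ _ = record_weight_prim n.+1 k.+1 +
    (k.+1%:R ^+ n.+1 / n.+1`!%:R : R) *:
      ((- @ln R) ^+ n.+1 * @id R ^+ k.+1)); last first.
  apply/funext => u; rewrite /record_weight_prim big_ord_recr/=.
  by rewrite !fctE.
apply: is_derive_eq; rewrite /record_weight /= !fctE.
rewrite -![_ *: _]/(_ * _) factS natrM !exprS.
have nz : n`!%:R != 0 :> R by rewrite gt_eqF// ltr0n fact_gt0.
by field; rewrite nz (gt_eqF x0) nat1r pnatr_eq0.
Qed.

Lemma continuous_record_weight n k x : 0 < x ->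
  {for x, continuous (record_weight n k)}.
Proof.
move=> x0; apply: cvgM; last exact: exprn_continuous.
apply: cvgM; first exact: cvg_cst.
apply: (@continuous_comp _ _ _ (fun u => - ln u) (fun u => u ^+ n.-1)).
  by apply: cvgN; exact: continuous_ln.
exact: exprn_continuous.
Qed.

Lemma integral_record_weight_itv n k x : 0 < x < 1 ->
  (\int[lebesgue_measure]_(u in `[x, 1%R]) (record_weight n.+1 k.+1 u)%:E =
   (1 - record_weight_prim n.+1 k.+1 x)%:E)%E.
Proof.
move=> /andP[x0 x1].
have dprim u : 0 < u -> is_derive u 1 (record_weight_prim n.+1 k.+1)
    (record_weight n.+1 k.+1 u) by exact: is_derive_record_weight_prim.
have cprim u : 0 < u -> {for u, continuous (record_weight_prim n.+1 k.+1)}.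
  move=> u0; apply/differentiable_continuous/derivable1_diffP.
  by have [] := dprim _ u0.
rewrite (@continuous_FTC2 _ _ (record_weight_prim n.+1 k.+1))//.
- rewrite EFinB; congr (_%:E - _)%E.
  (* At the endpoint 1 only the term of index 0 survives, because ln 1 = 0; it equals 1. *)
  rewrite /record_weight_prim big_ord_recl/= big1 => [|i _].
    by rewrite expr0 fact0 divr1 expr0 expr1n !mulr1 addr0.
  by rewrite ln1 oppr0 expr0n mul0r mulr0.
- apply: continuous_in_subspaceT => u; rewrite inE/= in_itv/= => /andP[xu _].
  by apply: continuous_record_weight; exact: lt_le_trans xu.
- split.
  + move=> u; rewrite in_itv/= => /andP[xu _].
    by have [] := dprim _ (lt_trans x0 xu).
  + exact/cvg_at_right_filter/cprim.
  + exact/cvg_at_left_filter/cprim.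
- move=> u; rewrite in_itv/= => /andP[xu _].
  by rewrite derive1E; have [] := dprim _ (lt_trans x0 xu).
Qed.

(** For y = j + 1, the bound exp y >= 1 + y^(i+1) / (i+1)! gives y^i exp (- y) <= (i+1)! / y, a
    constant times the harmonic sequence. *)
Lemma cvg_exprn_expRN i :
  j.+1%:R ^+ i * expR (- j.+1%:R) @[j --> \oo] --> (0 : R).
Proof.
apply: (@squeeze_cvgr _ _ _ _ (cst 0) (fun j => i.+1`!%:R * harmonic j)).
- apply: nearW => j; rewrite mulr_ge0 ?exprn_ge0 ?expR_ge0//=.
  rewrite expRN ler_pdivrMr ?expR_gt0// /harmonic/=.
  have := @expR_ge1Dxn R j.+1%:R i (ler0n _ _).
  set e := expR _ => le_e.
  have {}le_e : j.+1%:R ^+ i.+1 / i.+1`!%:R <= e by lra.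
  rewrite ler_pdivrMr ?ltr0n ?fact_gt0// exprSr in le_e.
  by rewrite mulrAC ler_pdivlMr ?ltr0n// [leRHS]mulrC.
- exact: cvg_cst.
- rewrite -[X in _ --> X](mulr0 i.+1`!%:R); apply: cvgM.
    exact: cvg_cst.
  exact: cvg_harmonic.
Qed.

(** At u = exp (- (j+1)) one has - ln u = j + 1 and u^(k+1) <= u, so each summand is at most a
    constant times (j+1)^i exp (- (j+1)). *)
Lemma cvg_record_weight_prim n k :
  record_weight_prim n k.+1 (expR (- j.+1%:R)) @[j --> \oo] --> 0.
Proof.
rewrite /record_weight_prim.
rewrite [X in _ --> X](_ : 0 = \sum_(i < n) (0 : R)); last by rewrite big1.
apply: cvg_big => [|i _]; first exact: add_continuous.
rewrite -[X in _ --> X](mulr0 (k.+1%:R ^+ i / i`!%:R)).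
apply: cvgM; first exact: cvg_cst.
apply: (@squeeze_cvgr _ _ _ _ (cst 0)
  (fun j => j.+1%:R ^+ i * expR (- j.+1%:R)));
  [|exact: cvg_cst|exact: cvg_exprn_expRN].
apply: nearW => j; rewrite expRK opprK mulr_ge0 ?exprn_ge0 ?expR_ge0//=.
by rewrite ler_wpM2l ?exprn_ge0// exprS ler_piMr ?expR_ge0//.
Qed.

Lemma integral_record_weight n k : (0 < n)%N -> (0 < k)%N ->
  (\int[lebesgue_measure]_(u in `[0%R, 1%R]) (record_weight n k u)%:E = 1)%E.
Proof.
case: n => // n _; case: k => // k _.
have mw D : measurable_fun D (fun u => (record_weight n.+1 k.+1 u)%:E).
  by apply: measurable_funTS; apply/measurable_EFinP;
    exact: measurable_record_weight.
(* The primitive is available only for u > 0. The endpoint 0 is dropped and ]0, 1] is exhausted by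
   the intervals [exp (- (j+1)), 1]. *)
rewrite -integral_itv_obnd_cbnd//.
pose I j : set R := `[expR (- j.+1%:R), 1]%classic.
have <- : \bigcup_j I j = `]0, 1]%classic.
  apply/seteqP; split => u /=.
    move=> [j _]; rewrite /I/= !in_itv/= => /andP[ju ->].
    by rewrite (lt_le_trans _ ju) ?expR_gt0.
  rewrite in_itv/= => /andP[u0 u1].
  (* An index j above - ln u satisfies exp (- (j+1)) <= u. *)
  exists (Num.bound (- ln u)) => //; rewrite /I/= in_itv/= u1 andbT.
  rewrite -[leRHS]lnK ?posrE// ler_expR lerNl.
  have := archi_boundP (_ : 0 <= - ln u); rewrite oppr_ge0 ln_le0// => /(_ isT).
  by move=> /ltW /le_trans; apply; rewrite ler_nat.
have I1 : (\int[lebesgue_measure]_(u in I j) (record_weight n.+1 k.+1 u)%:E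
    @[j --> \oo] --> 1)%E.
  apply: (@cvg_trans _ ((1 - record_weight_prim n.+1 k.+1
      (expR (- j.+1%:R)))%:E @[j --> \oo])).
    apply: near_eq_cvg; apply: nearW => j; rewrite integral_record_weight_itv//.
    by rewrite expR_gt0 expR_lt1 oppr_lt0 ltr0n.
  apply: cvg_EFin; first exact: nearW.
  rewrite -[X in _ --> X]subr0; apply: cvgB; first exact: cvg_cst.
  exact: cvg_record_weight_prim.
apply: (cvg_unique _ _ I1) => //.
apply: ge0_nondecreasing_set_cvg_integral => //.
- move=> i j ij; apply/subsetPset; apply: subset_itvr.
  by rewrite bnd_simp ler_expR lerN2 ler_nat.
- by move=> i; exact: measurable_itv.
- by move=> i; exact: mw.
- move=> i u; rewrite /I/= in_itv/= => /andP[iu u1].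
  by rewrite lee_fin record_weight_ge0// u1 andbT (le_trans _ iu)// expR_ge0.
Qed.

End record_weight.

(** * The distribution function of an atomless variable, and the uniform law of F(X) *)

Section rcdf_theory.
Context d (T : measurableType d) (R : realType) (P : probability T R).
Variable X : {RV P >-> R}.

Lemma EFin_rcdf x : (rcdf X x)%:E = cdf X x.
Proof. by rewrite fineK// fin_num_measure. Qed.

Lemma rcdf_ge0 x : 0 <= rcdf X x.
Proof. by rewrite -lee_fin EFin_rcdf cdf_ge0. Qed.

Lemma rcdf_le1 x : rcdf X x <= 1.
Proof. by rewrite -lee_fin EFin_rcdf cdf_le1. Qed.

Lemma rcdf_nondecreasing : nondecreasing_fun (rcdf X).
Proof. by move=> x y xy; rewrite -lee_fin !EFin_rcdf cdf_nondecreasing. Qed.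

Lemma measurable_rcdf D : measurable D -> measurable_fun D (rcdf X).
Proof.
by move=> mD; apply: nondecreasing_measurable => //; exact: rcdf_nondecreasing.
Qed.

Lemma measurable_rcdf_lt u : measurable [set x | rcdf X x < u].
Proof.
rewrite (_ : [set _ | _] = setT `&` rcdf X @^-1` `]-oo, u[).
  exact: measurable_rcdf.
by rewrite setTI; apply/seteqP; split => x; rewrite /= in_itv.
Qed.

Hypothesis atomless : forall x, distribution P X [set x] = 0%E.

Lemma distribution_itvNyo x : distribution P X `]-oo, x[ = (rcdf X x)%:E.
Proof.
rewrite EFin_rcdf /cdf -(@setUitv1 _ _ _ _ true)// measureU//; last first.
  by apply/seteqP; split => y //= [] /[swap] ->; rewrite in_itv/= ltxx.
by rewrite [X in (_ + X)%E]atomless adde0.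
Qed.

(** Right continuity holds for every distribution function. On the left, F(a - 1/(n+1)) tends to P(X
    < a), which is F(a) in the absence of atoms; monotonicity extends this from the sequence to all
    x near a. *)
Lemma continuous_rcdf : continuous (rcdf X).
Proof.
move=> a; apply/left_right_continuousP; split; last first.
  by apply: fine_cvg; rewrite EFin_rcdf; exact: cdf_right_continuous.
have Fa : rcdf X (a - n.+1%:R^-1) @[n --> \oo] --> rcdf X a.
  apply: (@fine_cvg _ _ _ _ (fun n => cdf X (a - n.+1%:R^-1))).
  rewrite -distribution_itvNyo.
  pose F n : set R := `]-oo, a - n.+1%:R^-1]%classic.
  have -> : `]-oo, a[%classic = \bigcup_n F n.
    apply/seteqP; split => y /=; last first.
      move=> [n _]; rewrite /F/= !in_itv/= => /le_lt_trans; apply.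
      by rewrite gtrBl.
    rewrite in_itv/= => ya.
    have : `[y, a[%classic y by rewrite /= in_itv/= lexx.
    rewrite itv_bnd_open_bigcup => -[n _]; rewrite /= in_itv/= => /andP[_ yn].
    by exists n.
  apply: (@nondecreasing_cvg_mu _ _ _ (distribution P X) F) => //.
  - by move=> n; exact: measurable_itv.
  - by apply: bigcup_measurable => n _; exact: measurable_itv.
  - move=> m n mn; apply/subsetPset; apply: subset_itvl.
    by rewrite bnd_simp lerD2l lerN2 lef_pV2 ?posrE// ler_nat.
apply/cvgrPdist_le => e e0.
have [N _ /(_ N (leqnn N)) FN] := proj1 (cvgrPdist_le _ _) Fa e e0.
near=> x.
have xa : x <= a by near: x; exact: nbhs_left_le.
have ax : a - N.+1%:R^-1 <= x.
  by near: x; apply: nbhs_left_ge; rewrite ltrBlDr ltrDl invr_gt0.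
rewrite ger0_norm ?subr_ge0 ?rcdf_nondecreasing//.
apply: le_trans FN; rewrite ger0_norm ?subr_ge0 ?rcdf_nondecreasing//.
  by rewrite lerD2l lerN2 rcdf_nondecreasing.
by rewrite gerBl.
Unshelve. all: by end_near. Qed.

(** The limits 0 and 1 at -oo and +oo supply points with F below and above [u]; the intermediate
    value theorem does the rest. *)
Lemma rcdf_surj u : 0 < u < 1 -> exists x, rcdf X x = u.
Proof.
move=> /andP[u0 u1].
have F0 : rcdf X x @[x --> -oo] --> (0 : R).
  by apply: fine_cvg; exact: cvg_cdfNy0.
have F1 : rcdf X x @[x --> +oo] --> (1 : R).
  by apply: fine_cvg; exact: cvg_cdfy1.
have [a Fa] : exists a, rcdf X a < u.
  exact: filter_ex (cvgr_lt _ F0 _ u0).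
have [b Fb] : exists b, u < rcdf X b.
  exact: filter_ex (cvgr_gt _ F1 _ u1).
have ab : a <= b.
  rewrite leNgt; apply/negP => /ltW/rcdf_nondecreasing.
  by rewrite leNgt (lt_trans Fa Fb).
have [||c _ <-] := @IVT _ (rcdf X) a b u ab; last by exists c.
  by apply: continuous_subspaceT; exact: continuous_rcdf.
by rewrite ge_min (ltW Fa) le_max (ltW Fb) orbT.
Qed.

(** If F(x) = u, the set lies in ]-oo, x], of mass u. Conversely, if F(x) = v < u, it contains ]-oo,
    x], of mass v, and v may be taken arbitrarily close to u. *)
Lemma distribution_rcdf_lt u : 0 < u <= 1 ->
  distribution P X [set x | rcdf X x < u] = u%:E.
Proof.
move=> /andP[u0 u1].
have mFu := measurable_rcdf_lt u.
apply/eqP; rewrite eq_le; apply/andP; split.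
  have [u_lt1|] := ltP u 1; last first.
    by move=> u1'; rewrite (le_trans (probability_le1 _ _))// lee_fin.
  have [x Fx] := rcdf_surj (introT andP (conj u0 u_lt1)).
  apply: (@le_trans _ _ (cdf X x)); last by rewrite -EFin_rcdf Fx.
  apply: (@le_measure _ _ _ (distribution P X)); rewrite ?inE//.
  move=> y /= Fy; rewrite in_itv/= leNgt.
  by apply: contraTN Fy => /ltW/rcdf_nondecreasing; rewrite Fx -leNgt.
apply/lee_subgt0Pr => e e0.
(* The maximum with [u / 2] keeps [v] positive when [e] exceeds [u]. *)
have [v /andP[v0 vu] ev] : exists2 v, 0 < v < u & u - e <= v.
  exists (Num.max (u / 2) (u - e)); last by rewrite le_max lexx orbT.
  by rewrite lt_max divr_gt0//= gt_max gtrBl e0 andbT; lra.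
have [x Fx] : exists x, rcdf X x = v.
  by apply: rcdf_surj; rewrite v0 (lt_le_trans vu).
apply: (@le_trans _ _ v%:E); first by rewrite -EFinB lee_fin.
rewrite -Fx EFin_rcdf /cdf.
apply: (@le_measure _ _ _ (distribution P X)); rewrite ?inE//.
move=> y /=; rewrite in_itv/= => /rcdf_nondecreasing/le_lt_trans; apply.
by rewrite Fx.
Qed.

(** The laws of F(X) and of the uniform variable on [0, 1] agree on the rays ]-oo, u[, which are
    stable under intersection and generate the Borel sets; hence the two laws are equal. *)
Lemma integral_rcdf (h : R -> \bar R) : measurable_fun setT h ->
  (forall u, 0 <= h u)%E ->
  (\int[P]_t h (rcdf X (X t)) =
   \int[lebesgue_measure]_(u in `[0%R, 1%R]) h u)%E.
Proof.
move=> mh h_ge0.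
have mFX : measurable_fun setT (rcdf X \o X).
  by apply: measurableT_comp => //; exact: measurable_rcdf.
(* Lebesgue measure lives on [measurableTypeR R], which has the measurable sets
   of [R] but another display, so the variable is retyped. *)
pose Y : {RV P >-> measurableTypeR R} :=
  HB.pack (rcdf X \o X : T -> measurableTypeR R)
    (isMeasurableFun.Build _ _ T (measurableTypeR R) (rcdf X \o X) mFX).
transitivity (\int[distribution P Y]_u h u)%E.
  by rewrite ge0_integral_distribution.
transitivity (\int[uniform_prob (@ltr01 R)]_u h u)%E; last first.
  by rewrite integral_uniform// subr0 invr1 mul1e.
apply: eq_measure_integral => A mA _.
apply: (@measure_unique _ R (measurableTypeR R) (@RGenInftyO.G R)
  (fun n => `]-oo, n%:R[%classic) _ _ _ _ (distribution P Y)
  (uniform_prob (@ltr01 R))) => //.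
- exact: RGenInftyO.measurableE.
- move=> _ _ [x ->] [y ->]; exists (Num.min x y).
  by apply/seteqP; split => z /=; rewrite !in_itv/= lt_min => /andP.
- by move=> n; exists n%:R.
- rewrite -subTset => x _; exists (Num.truncn x).+1 => //=.
  by rewrite in_itv/= truncnS_gt.
- move=> _ [u ->].
  rewrite -[RHS]/(\int[lebesgue_measure]_(x in `]-oo, u[)
                    (uniform_pdf 0 1 x)%:E)%E.
  rewrite integral_uniform_pdf.
  rewrite (eq_integral (cst 1%E)); last first.
    move=> x; rewrite inE/= !in_itv/= => -[_ x01].
    by rewrite /uniform_pdf x01 subr0 invr1.
  rewrite integral_cst ?mul1e/=; last exact: measurableI.
  (* Both masses of ]-oo, u[ are 0 for u <= 0, u for 0 < u <= 1, and 1 for u > 1. *)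
  have [u0|u0] := leP u 0.
    rewrite (_ : _ `&` _ = set0) ?measure0; last first.
      apply/seteqP; split => x //=; rewrite !in_itv/= => -[xu /andP[x0 _]].
      by have := lt_le_trans xu (le_trans u0 x0); rewrite ltxx.
    rewrite /distribution/pushforward (_ : _ @^-1` _ = set0) ?measure0//.
    apply/seteqP; split => x //=; rewrite in_itv/= => Fu.
    by move: Fu; rewrite ltNge (le_trans u0 (rcdf_ge0 _)).
  have -> : distribution P Y `]-oo, u[ =
      distribution P X [set x | rcdf X x < u].
    by congr (P _); apply/seteqP; split => x /=; rewrite in_itv.
  have [u1|u1] := leP u 1.
    rewrite distribution_rcdf_lt ?u0//.
    rewrite (_ : _ `&` _ = `[0, u[%classic).
      by rewrite lebesgue_measure_itv/= lte_fin u0 sube0.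
    apply/seteqP; split => x /=; rewrite !in_itv/=.
      by move=> [-> /andP[->]].
    by move=> /andP[-> xu]; split => //=; rewrite ltW// (lt_le_trans xu).
  rewrite (_ : _ `&` _ = `[0, 1]%classic); last first.
    apply/seteqP; split => x /=; rewrite !in_itv/=; first by case.
    by move=> /andP[-> x1]; rewrite x1 (le_lt_trans x1).
  rewrite lebesgue_measure_itv/= lte_fin ltr01 sube0.
  rewrite (_ : [set _ | _] = setT) ?probability_setT//.
  by apply/seteqP; split => x //= _; exact: le_lt_trans (rcdf_le1 _) u1.
- by move=> n; rewrite (le_lt_trans (probability_le1 _ _)) ?ltry.
Qed.

End rcdf_theory.

(** * Measurability, sign and total mass of the record densities *)

Section record_pdf.
Context d (T : measurableType d) (R : realType) (P : probability T R).
Variables (X : {RV P >-> R}) (f : R -> R).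
Hypothesis f_pdf : is_pdf X f.

Lemma measurable_pdf_support : measurable (pdf_support f).
Proof.
have [mf _ _] := f_pdf.
rewrite (_ : pdf_support f = setT `&` f @^-1` `]0, +oo[).
  by apply: mf => //; exact: measurable_itv.
by rewrite setTI; apply/seteqP; split => x; rewrite /= in_itv/= andbT.
Qed.

Lemma pdf_atomless x : distribution P X [set x] = 0%E.
Proof. by have [_ _ ->//] := f_pdf; rewrite integral_set1. Qed.

Lemma measurable_lower_record_pdf n k D : measurable D ->
  measurable_fun D (lower_record_pdf (rcdf X) f n k).
Proof.
move=> mD; have [mf _ _] := f_pdf; apply: measurable_funTS.
apply: measurable_funM => //.
apply: (measurableT_comp (measurable_record_weight n k)).
exact: measurable_rcdf.
Qed.

Lemma lower_record_pdf_ge0 n k x : 0 <= lower_record_pdf (rcdf X) f n k x.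
Proof.
have [_ f0 _] := f_pdf; rewrite mulr_ge0//.
by apply: record_weight_ge0; rewrite rcdf_ge0 rcdf_le1.
Qed.

(** As [f] is the density of the law of X, the integral is the expectation of the weight at F(X),
    hence the integral of the weight over [0, 1]. *)
Lemma integral_lower_record_pdf n k : (0 < n)%N -> (0 < k)%N ->
  (\int[lebesgue_measure]_(x in pdf_support f)
     (lower_record_pdf (rcdf X) f n k x)%:E = 1)%E.
Proof.
move=> n0 k0; have [mf f0 fE] := f_pdf.
pose X' : {RV P >-> measurableTypeR R} := HB.pack (X : T -> measurableTypeR R)
  (isMeasurableFun.Build _ _ T (measurableTypeR R) X
    (measurable_funPT X)).
(* The weight may be negative beyond 1, whereas the changes of variable are for nonnegative
   functions. Cutting it off outside [0, 1] costs nothing, since F takes its values there. *)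
pose h : R -> \bar R := (EFin \o record_weight n k) \_ `[0, 1]%classic.
have hE x : h (rcdf X x) = (record_weight n k (rcdf X x))%:E.
  by rewrite /h patchE mem_set//= in_itv/= rcdf_ge0 rcdf_le1.
have h_ge0 u : (0 <= h u)%E.
  rewrite /h; apply: erestrict_ge0 => {}u /=.
  by rewrite in_itv/= lee_fin; exact: record_weight_ge0.
have mh : measurable_fun setT h.
  apply/(measurable_restrictT _ _).1; first exact: measurable_itv.
  by apply: measurable_funTS; apply/measurable_EFinP;
    exact: measurable_record_weight.
transitivity (\int[lebesgue_measure]_x (h (rcdf X x) * (f x)%:E))%E.
  rewrite integral_mkcond; apply: eq_integral => x _.
  rewrite hE -EFinM patchE; case: ifPn => // /negP xf.
  suff -> : f x = 0 by rewrite mulr0.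
  apply/eqP; rewrite eq_le f0 andbT leNgt; apply/negP => fx.
  by apply: xf; rewrite inE.
transitivity (\int[distribution P X']_x h (rcdf X x))%E.
  apply/esym/ge0_integral_density => //.
  exact: measurableT_comp mh (measurable_rcdf X measurableT).
rewrite ge0_integral_distribution//; last first.
  exact: measurableT_comp mh (measurable_rcdf X measurableT).
transitivity (\int[P]_t h (rcdf X (X t)))%E; first by [].
rewrite integral_rcdf//; last exact: pdf_atomless.
rewrite -(integral_record_weight R n0 k0); apply: eq_integral => u u01.
by rewrite /h patchE u01.
Qed.

End record_pdf.

(** * The sign change of the difference of consecutive weights *)

Section record_weight_crossing.
Variable R : realType.

Lemma record_weightS n k (u : R) : (0 < n)%N ->
  record_weight n.+1 k u = record_weight n k u * (k%:R / n%:R * - ln u).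
Proof.
case: n => // n _; rewrite /record_weight /= factS natrM !exprS.
have nz : n`!%:R != 0 :> R by rewrite gt_eqF// ltr0n fact_gt0.
by field; rewrite nz nat1r pnatr_eq0.
Qed.

(** The point u where the ratio (k / n) (- ln u) of consecutive weights equals 1. *)
Definition record_crossing n k : R := expR (- (n%:R / k%:R)).

Lemma record_crossing_gt0_lt1 n k : (0 < n)%N -> (0 < k)%N ->
  0 < record_crossing n k < 1.
Proof.
by move=> n0 k0; rewrite expR_gt0 expR_lt1 oppr_lt0 divr_gt0 ?ltr0n.
Qed.

Lemma record_weight_le_before n k u : (0 < n)%N -> (0 < k)%N -> 0 < u <= 1 ->
  u < record_crossing n k -> record_weight n k u <= record_weight n.+1 k u.
Proof.
move=> n0 k0 /andP[u0 u1]; rewrite -[ltLHS]lnK ?posrE// ltr_expR => uc.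
rewrite record_weightS// ler_peMr ?record_weight_ge0 ?(ltW u0)//.
rewrite mulrC mulrA ler_pdivlMr ?ltr0n// mul1r -ler_pdivrMr ?ltr0n//.
by rewrite lerNr ltW.
Qed.

Lemma record_weight_ge_after n k u : (0 < n)%N -> (0 < k)%N -> 0 < u <= 1 ->
  record_crossing n k <= u -> record_weight n.+1 k u <= record_weight n k u.
Proof.
move=> n0 k0 /andP[u0 u1]; rewrite -[leRHS]lnK ?posrE// ler_expR => uc.
rewrite record_weightS// ler_piMr ?record_weight_ge0 ?(ltW u0)//.
rewrite mulrC mulrA ler_pdivrMr ?ltr0n// mul1r -ler_pdivlMr ?ltr0n//.
by rewrite lerNl.
Qed.

End record_weight_crossing.

(** * A level separating the values of ln f on the two sides of the crossing *)

Section crossing_level.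
Context d (T : measurableType d) (R : realType) (P : probability T R).
Variables (X : {RV P >-> R}) (f : R -> R).
Hypothesis f_pdf : is_pdf X f.

(** On a set that misses the support [f] vanishes, and so does its integral, which is the
    probability of the set. *)
Lemma pdf_support_meets (A : set R) : measurable A ->
  distribution P X A != 0%E -> exists2 x, A x & pdf_support f x.
Proof.
have [_ f0 fE] := f_pdf => mA; rewrite fE// => /eqP A0.
apply: contrapT => nA; apply: A0; rewrite integral0_eq// => x Ax.
congr (_%:E); apply/eqP; rewrite eq_le f0 andbT leNgt; apply/negP => fx.
by apply: nA; exists x.
Qed.

Lemma pdf_support_rcdf_lt u : 0 < u < 1 ->
  exists2 x, pdf_support f x & rcdf X x < u.
Proof.
move=> /andP[u0 u1].
have [||x] := @pdf_support_meets [set x | rcdf X x < u].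
- exact: measurable_rcdf_lt.
- rewrite distribution_rcdf_lt ?u0 ?ltW//; last exact: pdf_atomless f_pdf.
  by rewrite eqe gt_eqF.
- by exists x.
Qed.

Lemma pdf_support_rcdf_ge u : 0 < u < 1 ->
  exists2 x, pdf_support f x & u <= rcdf X x.
Proof.
move=> /andP[u0 u1].
have [||x /negP] := @pdf_support_meets (~` [set x | rcdf X x < u]).
- by apply: measurableC; exact: measurable_rcdf_lt.
- have -> : distribution P X (~` [set x | rcdf X x < u]) = (1 - u%:E)%E.
    apply: etrans (probability_setC _ (measurable_rcdf_lt X u)) _.
    congr (1 - _)%E; apply: distribution_rcdf_lt.
      exact: pdf_atomless f_pdf.
    by rewrite u0 ltW.
  by rewrite -EFinB eqe gt_eqF// subr_gt0.
- by rewrite -leNgt; exists x.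
Qed.

Hypothesis f_incr : {in pdf_support f &, {homo f : x y / x <= y}}.

(** The level is the supremum of ln f over the support points with F < u. By monotonicity of F these
    lie to the left of those with F >= u, so ln f at any of the latter is an upper bound. Both sides
    are nonempty, having probabilities u and 1 - u. *)
Lemma crossing_level u : 0 < u < 1 -> exists c, forall x, pdf_support f x ->
  (rcdf X x < u -> ln (f x) <= c) /\ (u <= rcdf X x -> c <= ln (f x)).
Proof.
move=> u01.
have le_ln x y : pdf_support f x -> pdf_support f y -> rcdf X x < u ->
    u <= rcdf X y -> ln (f x) <= ln (f y).
  move=> Sx Sy Fx Fy; rewrite ler_ln ?posrE//; apply: f_incr; rewrite ?inE//.
  rewrite leNgt; apply/negP => /ltW/(rcdf_nondecreasing X).
  by rewrite leNgt (lt_le_trans Fx Fy).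
pose E := [set ln (f x) | x in pdf_support f `&` [set x | rcdf X x < u]].
have [a Sa Fa] := pdf_support_rcdf_lt u01.
have [b Sb Fb] := pdf_support_rcdf_ge u01.
have E0 : E !=set0 by exists (ln (f a)); exists a.
exists (sup E) => x Sx; split => Fx.
  apply: ub_le_sup; last by exists x.
  by exists (ln (f b)) => _ [z [Sz Fz] <-]; exact: le_ln.
by apply: ge_sup => // _ [z [Sz Fz] <-]; exact: le_ln.
Qed.

End crossing_level.

(** * Monotonicity in n of the inaccuracy of lower record values *)

Theorem theorem3 (R : realType) (d : measure_display) (T : measurableType d)
    (P : probability T R) (X : {RV P >-> R}) (f : R -> R)
    (f_pdf : is_pdf X f)
    (F_cont : {within pdf_support f, continuous (rcdf X)})
    (F_incr : {in pdf_support f &, {homo rcdf X : x y / x < y}})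
    (k : nat) (k_gt0 : (1 <= k)%N)
    (f_incr : {in pdf_support f &, {homo f : x y / x <= y}}) :
  forall n : nat, (1 <= n)%N ->
    kerridge_well_defined (lower_record_pdf (rcdf X) f n k) f ->
    kerridge_well_defined (lower_record_pdf (rcdf X) f n.+1 k) f ->
    (kerridge (lower_record_pdf (rcdf X) f n k) f
       <= kerridge (lower_record_pdf (rcdf X) f n.+1 k) f)%E.
Proof.
move=> n n_gt0; set g := lower_record_pdf _ _ n k.
set g' := lower_record_pdf _ _ n.+1 k.
(* The sign in the inaccuracy reverses the order: the integral of g' ln f has to be at most that of
   g ln f. *)
rewrite /kerridge_well_defined /kerridge leeN2.
have [mf f_ge0 _] := f_pdf; have mS := measurable_pdf_support f_pdf.
(* By strict monotonicity F vanishes at one point of the support at most. *)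
have [r rP] : exists r, forall x, (pdf_support f `\ r) x -> 0 < rcdf X x.
  have [[r [Sr Fr]]|nS] := pselect (exists r, pdf_support f r /\ rcdf X r = 0).
    exists r => x [Sx /eqP xr]; rewrite lt_neqAle rcdf_ge0 andbT eq_sym.
    apply/eqP => Fx; move: xr; rewrite neq_lt => /orP[xr|rx].
      by have := F_incr x r (mem_set Sx) (mem_set Sr) xr; rewrite Fx Fr ltxx.
    by have := F_incr r x (mem_set Sr) (mem_set Sx) rx; rewrite Fx Fr ltxx.
  exists 0 => x [Sx _]; rewrite lt_neqAle rcdf_ge0 andbT eq_sym.
  by apply/eqP => Fx; apply: nS; exists x.
have [c cP] :=
  crossing_level f_pdf f_incr (record_crossing_gt0_lt1 R n_gt0 k_gt0).
set D := pdf_support f `\ r in rP *.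
have mD : measurable D by exact: measurableD.
(* Removing the null point [r] changes no integral, and on [D] the positivity of F excludes the
   default value ln 0 = 0. *)
have SD (h : R -> \bar R) : measurable_fun D h ->
    (\int[lebesgue_measure]_(x in pdf_support f) h x =
     \int[lebesgue_measure]_(x in D) h x)%E.
  by move=> mh; rewrite integral_setD1.
have mlnf : measurable_fun D (fun x => ln (f x)).
  by apply: measurable_funTS; exact: measurableT_comp (@measurable_ln R) mf.
have mK m :
    measurable_fun D (fun x => lower_record_pdf (rcdf X) f m k x * ln (f x)).
  by apply: measurable_funM => //; exact: measurable_lower_record_pdf.
have mE m : measurable_fun D (EFin \o lower_record_pdf (rcdf X) f m k).
  by apply/measurable_EFinP; exact: measurable_lower_record_pdf.
have int1 m : (0 < m)%N -> (\int[lebesgue_measure]_(x in D)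
    (lower_record_pdf (rcdf X) f m k x)%:E = 1)%E.
  by move=> m0; rewrite -SD ?integral_lower_record_pdf//; exact: mE.
have intg m : (0 < m)%N -> lebesgue_measure.-integrable D
    (EFin \o lower_record_pdf (rcdf X) f m k).
  move=> m0; apply/integrableP; split; first exact: mE.
  under eq_integral do rewrite /= ger0_norm ?(lower_record_pdf_ge0 f_pdf)//.
  by rewrite int1 ?ltry.
have mKE m : measurable_fun D
    (kerridge_integrand (lower_record_pdf (rcdf X) f m k) f).
  by apply/measurable_EFinP; exact: mK.
have mKp m := measurable_funepos (mKE m).
have mKn m := measurable_funeneg (mKE m).
rewrite (SD _ (mKp n)) (SD _ (mKn n)) (SD _ (mKp n.+1)) (SD _ (mKn n.+1)).
rewrite (SD _ (mKE n)) (SD _ (mKE n.+1)).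
move=> wg wg'.
(* The correction c (g' - g) has integral 0 because g and g' both have mass 1. *)
apply: (@le_integral_well_defined _ _ R lebesgue_measure D mD
  (fun x => g x * ln (f x)) (fun x => g' x * ln (f x))
  (fun x => c * (g' x - g x))) => //.
- exact: mK.
- exact: mK.
- rewrite (_ : _ \o _ =
      (fun x => c%:E * ((EFin \o g') \- (EFin \o g)) x)%E); last first.
    by apply/funext => x /=; rewrite -EFinB -EFinM.
  by apply: integrableZl => //; apply: integrableB => //; exact: intg.
- under eq_integral do rewrite EFinM EFinB.
  rewrite integralZl//; last by apply: integrableB => //; exact: intg.
  by rewrite integralB ?int1 ?subee ?mule0//; exact: intg.
move=> x Dx; have [Sx _] := Dx; have [cl cr] := cP x Sx.
have F01 : 0 < rcdf X x <= 1 by rewrite rP// rcdf_le1.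
rewrite -subr_ge0.
(* The pointwise bound becomes the nonnegativity of a product: both factors are nonnegative before
   the crossing and nonpositive after it. *)
have -> : g x * ln (f x) + c * (g' x - g x) - g' x * ln (f x) =
    (g' x - g x) * (c - ln (f x)) by ring.
have [Fx|Fx] := ltP (rcdf X x) (record_crossing R n k).
  apply: mulr_ge0; last by rewrite subr_ge0 cl.
  by rewrite subr_ge0 ler_wpM2r// record_weight_le_before.
apply: mulr_le0; last by rewrite subr_le0 cr.
by rewrite subr_le0 ler_wpM2r// record_weight_ge_after.
Qed.
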